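(* Let $m\in\mathbb N$ and let $(X^1_n)_{n\in\mathbb N},\dots,(X^m_n)_{n\in\mathbb N}$ be independent sequences of positive integrable random variables, with multiplicative Doob decompositions $$X_n^i=M_n^i\prod_{j=1}^{n}\frac{E(X_j^i\mid\mathcal A_{j-1})}{X_{j-1}^i},\qquad i=1,\dots,m.$$ Assume that for each $i=1,\dots,m$ $$E\left(\frac{X^i_{n+1}}{X^i_n}\,\Big|\,\mathcal A_n\right)\quad\text{is non-increasing in } n.$$ Put $X_n=\prod_{i=1}^mX^i_n$. Then: (i) The stopping problem for $(X_n)_{n\in\mathbb N}$ is a monotone case problem, with myopic rule $$\tau^*=\inf\left\{n:\ \prod_{i=1}^mE\left(\frac{X_{n+1}^i}{X_n^i}\,\Big|\,\mathcal A_n\right)\leq 1\right\}.$$ (ii) If $\lim_{L\to\infty}EX_{\min\{\tau^*,L\}}\leq EX_{\tau^*}$, then $\tau^*$ is optimal, i.e. $EX_{\tau^*}=\sup_\tau EX_\tau$.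
   Context: $\mathbb N=\{1,2,\dots\}$. The filtration $(\mathcal A_n)_{n\in\mathbb N}$ is the joint filtration of the independent sequences: $\mathcal A_n=\sigma(\mathcal A^1_n\cup\dots\cup\mathcal A^m_n)$, where $(\mathcal A^1_n)_n,\dots,(\mathcal A^m_n)_n$ are independent filtrations and $(X^i_n)_n$ is adapted to $(\mathcal A^i_n)_n$ (for instance the filtration it generates). Conventions: $X^i_0=1$, $\mathcal A_0=\{\emptyset,\Omega\}$. In the multiplicative Doob decomposition, $$M^i_n=\prod_{k=1}^n\frac{X^i_k}{E(X^i_k\mid\mathcal A_{k-1})},\quad n\ge1,$$ which is a martingale with mean $1$. All stopping times are with respect to $(\mathcal A_n)_{n\in\mathbb N}$, take values in $\{1,2,\dots\}\cup\{\infty\}$ (not necessarily finite a.s.), and $X_\infty:=\liminf_{n\to\infty}X_n$. The supremum $\sup_\tau EX_\tau$ is over all stopping times $\tau$ for which $EX_\tau$ exists. The stopping problem for an adapted integrable sequence $(X_n)_{n\in\mathbb N}$ is called a monotone case problem if for all $n\in\mathbb N$ $$\{E(X_{n+1}\mid\mathcal A_n)\leq X_n\}\subseteq\{E(X_{n+2}\mid\mathcal A_{n+1})\leq X_{n+1}\}.$$ Its myopic rule (myopic stopping time) is $\tau^*=\inf\{n: E(X_{n+1}\mid\mathcal A_n)\leq X_n\}$, with $\inf\emptyset=\infty$. (In)equalities between random variables are understood almost surely. *)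

(* Defs.v *)
From HB Require Import structures.
From mathcomp Require Import all_boot all_order all_algebra.
From mathcomp Require Import all_classical all_reals all_analysis.
Set Implicit Arguments.
Unset Strict Implicit.
Unset Printing Implicit Defensive.
Import Order.TTheory GRing.Theory Num.Theory.
Import numFieldNormedType.Exports.
Local Open Scope classical_set_scope.
Local Open Scope ring_scope.

Section Filtrations.
Context (d : measure_display) (T : measurableType d) (R : realType).
Implicit Types (G : set (set T)) (F : nat -> set (set T)).

Definition sub_sigma_field G : Prop :=
  sigma_algebra [set: T] G /\ (forall B, G B -> measurable B).

Definition wrt_measurable G (Y : T -> R) : Prop :=
  forall B : set R, measurable B -> G (Y @^-1` B).

(* Processes are indexed by n >= 1; the index 0 carries the conventional
   initial value and the trivial sigma-field. *)
Definition filtration F : Prop :=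
  [/\ forall n, sub_sigma_field (F n),
      forall n k, (n <= k)%N -> F n `<=` F k &
      F 0%N = [set set0; [set: T]]].

Definition adapted F (X : nat -> T -> R) : Prop :=
  forall n, (0 < n)%N -> wrt_measurable (F n) (X n).

Definition joint_filtration (m : nat) (A : 'I_m -> nat -> set (set T)) :
    nat -> set (set T) :=
  fun n => <<s \bigcup_i A i n >>.

End Filtrations.

Section Probability.
Context (d : measure_display) (T : measurableType d) (R : realType).
Variable P : probability T R.
Implicit Types (G : set (set T)) (F : nat -> set (set T)).

Definition independent_families (m : nat) (G : 'I_m -> set (set T)) : Prop :=
  forall (J : {set 'I_m}) (B : 'I_m -> set T),
    (forall i, i \in J -> G i (B i)) ->
    P (\bigcap_(i in [set` J]) B i) = (\prod_(i in J) P (B i))%E.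

Definition independent_filtrations (m : nat)
    (A : 'I_m -> nat -> set (set T)) : Prop :=
  independent_families (fun i => <<s \bigcup_n A i n >>).

(* Integrability of X is not required: for X >= 0 this is the conditional
   expectation of a nonnegative random variable, with a finite version.  For
   instance E(X_{n+1} / X_n | F_n) is given by E(X_{n+1} | F_n) / X_n, even when
   X_{n+1} / X_n is not integrable. *)
Definition is_cond_exp G (X Y : T -> R) : Prop :=
  wrt_measurable G Y /\
  forall B, G B -> (\int[P]_(w in B) (Y w)%:E = \int[P]_(w in B) (X w)%:E)%E.

(* A fixed version of E(X | G); the default 0 is only used when X has no
   finite-valued conditional expectation. *)
Definition cond_exp G (X : T -> R) : T -> R :=
  xget (cst 0) [set Y | is_cond_exp G X Y].

Definition mult_doob_martingale F (X : nat -> T -> R) : nat -> T -> R :=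
  fun n w => \prod_(1 <= k < n.+1) (X k w / cond_exp (F k.-1) (X k) w).

(* Random times with values in {1, 2, ...} U {oo} are functions to [option nat]
   avoiding [Some 0], where [None] stands for oo. *)
Definition stopping_time F (tau : T -> option nat) : Prop :=
  (forall w, tau w <> Some 0%N) /\
  (forall n, (0 < n)%N -> F n [set w | tau w = Some n]).

(* inf {n >= 1 | p n}, with inf of the empty set equal to oo *)
Definition first_time (p : pred nat) : option nat :=
  if pselect (exists n, (0 < n)%N && p n) is left ex then Some (ex_minn ex)
  else None.

Definition min_time (tau : T -> option nat) (L : nat) : T -> option nat :=
  fun w => if tau w is Some n then Some (minn n L) else Some L.

(* X_tau, with X_oo = liminf X_n *)
Definition stopped (X : nat -> T -> R) (tau : T -> option nat) : T -> \bar R :=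
  fun w => if tau w is Some n then (X n w)%:E
           else limn_einf (fun n => (X n w)%:E).

Definition expectation_exists (Y : T -> \bar R) : Prop :=
  (\int[P]_w (Y^\+ w) < +oo)%E \/ (\int[P]_w (Y^\- w) < +oo)%E.

Definition stopping_value F (X : nat -> T -> R) : \bar R :=
  ereal_sup [set (\int[P]_w stopped X tau w)%E | tau in
    [set tau | stopping_time F tau /\ expectation_exists (stopped X tau)]].

Definition optimal F (X : nat -> T -> R) (tau : T -> option nat) : Prop :=
  [/\ stopping_time F tau, expectation_exists (stopped X tau) &
      (\int[P]_w stopped X tau w)%E = stopping_value F X].

Definition monotone_case F (X : nat -> T -> R) : Prop :=
  [/\ adapted F X,
      forall n, (0 < n)%N -> P.-integrable [set: T] (EFin \o X n) &
      forall n, (0 < n)%N ->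
        {ae P, forall w, cond_exp (F n) (X n.+1) w <= X n w ->
                         cond_exp (F n.+1) (X n.+2) w <= X n.+1 w}].

Definition myopic_time F (X : nat -> T -> R) : T -> option nat :=
  fun w => first_time (fun n => cond_exp (F n) (X n.+1) w <= X n w).

End Probability.

(* Main.v *)
(** By independence, E(prod_i X^i_(n+1) | A_n) = prod_i E(X^i_(n+1) | A^i_n), and
    the same identity with all factors but one equal to 1 shows that
    E(X^i_(n+1) | A_n) = E(X^i_(n+1) | A^i_n).  Hence E(X_(n+1) | A_n) / X_n is the
    product of the conditional ratios, which are nonnegative and non-increasing
    in n: this is the monotone case, with the stated myopic rule.
    For the optimality of tau*, put D_n = E(X_(n+1) | A_n) - X_n.  A stopping
    time tau gains E(D_L; tau > L) between the truncations at L and L + 1, and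
    this is at most E(max(D_L, 0)) = E(D_L; tau* > L), since {tau* > L} = {D_L > 0}
    a.s. in the monotone case.  So E X_(tau /\ L) <= E X_(tau* /\ L) for all
    L >= 1, and Fatou's lemma gives E X_tau <= lim_L E X_(tau* /\ L). *)

Require Import Defs.
From HB Require Import structures.
From mathcomp Require Import all_boot all_order all_algebra.
From mathcomp Require Import all_classical all_reals all_analysis measurable_realfun.
Import Order.TTheory GRing.Theory Num.Theory.
Import numFieldNormedType.Exports.
Local Open Scope classical_set_scope.
Local Open Scope ring_scope.

Set Implicit Arguments.
Unset Strict Implicit.
Unset Printing Implicit Defensive.

(** * Conditional expectation *)

Section WeightedIntegrals.
Local Open Scope ereal_scope.
Context (d : measure_display) (T : measurableType d) (R : realType).
Variable mu : {measure set T -> \bar R}.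

Import HBNNSimple.

Let nnsfun_comp_mulE (g : {nnsfun R >-> R}) (Z : T -> R) (W : T -> \bar R) w :
  (g (Z w))%:E * W w =
  \sum_(x \in range g) (x%:E * (W \_ (Z @^-1` (g @^-1` [set x]))) w).
Proof.
have gfin : finite_set (range g) by exact: fimfunP.
rewrite (@fsbigD1 _ _ _ _ (g (Z w)))/=; last first.
- by exists (Z w).
- exact: sub_finite_set gfin.
rewrite patchE mem_set//= fsbig1 ?adde0// => x [_ /= xg].
by rewrite patchE memNset ?mule0//= => /esym.
Qed.

Let ge0_integral_nnsfun_comp (g : {nnsfun R >-> R}) (Z : T -> R)
    (W : T -> \bar R) :
  measurable_fun [set: T] Z ->
  measurable_fun [set: T] W -> (forall w, 0 <= W w) ->
  \int[mu]_w ((g (Z w))%:E * W w) =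
  \sum_(x \in range g) (x%:E * \int[mu]_(w in Z @^-1` (g @^-1` [set x])) W w).
Proof.
move=> mZ mW W0.
have mZg x : measurable (Z @^-1` (g @^-1` [set x])).
  by rewrite -[X in measurable X]setTI; apply: mZ => //; exact: measurable_sfunP.
under eq_integral do rewrite nnsfun_comp_mulE.
have gx0 x w : 0 <= x%:E * (W \_ (Z @^-1` (g @^-1` [set x]))) w.
  rewrite patchE; case: ifPn; rewrite ?mule0// inE/= => <-.
  by rewrite mule_ge0// lee_fin.
rewrite ge0_integral_fsum//; last first.
  move=> x; apply: measurable_funeM; apply/(measurable_restrictT _ (mZg x)).
  exact: measurable_funTS.
apply: eq_fsbigr => x; rewrite inE => -[y _ <-].
rewrite ge0_integralZl//; last 3 first.
- by apply/(measurable_restrictT _ (mZg _)); exact: measurable_funTS.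
- by move=> w _; rewrite patchE; case: ifPn.
- by rewrite lee_fin.
by rewrite -integral_mkcond.
Qed.

(** Approximate the weight [Z] from below by simple functions of [Z]. Their level sets lie in [G],
    where [W] and [U] have equal integrals, and monotone convergence passes to the limit. *)
Lemma ge0_integralM_eq (G : set (set T)) (Z W U : T -> R) :
  sub_sigma_field G -> wrt_measurable G Z -> (forall w, 0 <= Z w)%R ->
  measurable_fun [set: T] W -> (forall w, 0 <= W w)%R ->
  measurable_fun [set: T] U -> (forall w, 0 <= U w)%R ->
  (forall B, G B -> \int[mu]_(w in B) (W w)%:E = \int[mu]_(w in B) (U w)%:E) ->
  \int[mu]_w (Z w * W w)%:E = \int[mu]_w (Z w * U w)%:E.
Proof.
move=> [_ Gm] GZ Z0 mW W0 mU U0 WU.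
have mZ : measurable_fun [set: T] Z.
  by move=> _ B mB; rewrite setTI; apply/Gm/GZ.
(* The approximation is made on the real line and then composed with [Z], so that every level set is
   a preimage under [Z] and hence in [G]. It approximates the absolute value, which is nonnegative
   on the whole line and fixes the values of [Z]. *)
have mnorm : measurable_fun [set: R] (fun x : R => `|x|%:E).
  by apply/measurable_EFinP; exact: normr_measurable.
pose g := nnsfun_approx measurableT mnorm.
have gE (V : T -> R) : measurable_fun [set: T] V -> (forall w, 0 <= V w)%R ->
    \int[mu]_w (Z w * V w)%:E =
    limn (fun n => \int[mu]_w ((g n (Z w))%:E * (V w)%:E)).
  move=> mV V0; rewrite -monotone_convergence//; last 3 first.
  - move=> n; apply: emeasurable_funM; apply/measurable_EFinP => //.
    by apply: measurableT_comp.
  - by move=> n w _; rewrite mule_ge0// lee_fin.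
  - move=> w _ m n mn; apply: lee_wpmul2r; rewrite lee_fin//.
    exact/lefP/nd_nnsfun_approx.
  apply: eq_integral => w _; apply/esym/cvg_lim => //.
  rewrite -[in X in _ --> X](ger0_norm (Z0 w)) EFinM; apply: cvgeZr => //.
  exact: (cvg_nnsfun_approx measurableT mnorm (fun x _ => normr_ge0 x)).
rewrite !gE//; congr (limn _); apply/funext => n.
rewrite !ge0_integral_nnsfun_comp//; last 2 first.
- exact/measurable_EFinP.
- exact/measurable_EFinP.
apply: eq_fsbigr => x _; rewrite WU//; apply: GZ; exact: measurable_sfunP.
Qed.

End WeightedIntegrals.

(** * Measurability with respect to a sub-sigma-field *)

Section SubSigmaFields.
Context (d : measure_display) (T : measurableType d) (R : realType).
Implicit Types (G : set (set T)) (Y : T -> R).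

(** A sigma-algebra generates itself. This turns [wrt_measurable G] into ordinary measurability on
    the type [g_sigma_algebraType G], where the general closure properties apply. *)
Lemma sub_sigma_field_measurableE G :
  sub_sigma_field G -> @measurable _ (g_sigma_algebraType G) = G.
Proof. by move=> [sG _]; exact: sigma_algebra_id. Qed.

Lemma wrt_measurableP G Y : sub_sigma_field G ->
  wrt_measurable G Y <-> measurable_fun [set: g_sigma_algebraType G] Y.
Proof.
move=> sG; have GE := sub_sigma_field_measurableE sG; split.
  by move=> GY _ B mB; rewrite setTI GE; exact: GY.
by move=> mY B mB; rewrite -GE -[X in measurable X]setTI; exact: mY.
Qed.

Lemma wrt_measurable_fun G Y : sub_sigma_field G -> wrt_measurable G Y ->
  measurable_fun [set: T] Y.
Proof. by move=> [_ Gm] GY _ B mB; rewrite setTI; exact/Gm/GY. Qed.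

Lemma wrt_measurable_sub G G' Y : G `<=` G' -> wrt_measurable G Y ->
  wrt_measurable G' Y.
Proof. by move=> GG' GY B mB; exact/GG'/GY. Qed.

Lemma wrt_measurable_prod G (I : eqType) (s : seq I) (f : I -> T -> R) :
  sub_sigma_field G -> (forall i, wrt_measurable G (f i)) ->
  wrt_measurable G (fun w => \prod_(i <- s) f i w).
Proof.
move=> sG Gf; apply/wrt_measurableP => //.
by apply: (@measurable_prod _ (g_sigma_algebraType G)) => i _; exact/wrt_measurableP.
Qed.

Lemma wrt_measurable_le G (f g : T -> R) : sub_sigma_field G ->
  wrt_measurable G f -> wrt_measurable G g -> G [set w | f w <= g w].
Proof.
move=> sG Gf Gg; rewrite -[X in X _](sub_sigma_field_measurableE sG).
rewrite -[X in measurable X]setTI.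
by apply: (@measurable_fun_le _ (g_sigma_algebraType G)) => //;
  exact/wrt_measurableP.
Qed.

Lemma sub_sigma_fieldT G : sub_sigma_field G -> G [set: T].
Proof.
move=> sG; rewrite -[X in X _](sub_sigma_field_measurableE sG).
exact: measurableT.
Qed.

Lemma sub_sigma_fieldC G B : sub_sigma_field G -> G B -> G (~` B).
Proof.
move=> sG; rewrite -[X in X _ -> X _](sub_sigma_field_measurableE sG).
exact: measurableC.
Qed.

Lemma sub_sigma_fieldI G B C : sub_sigma_field G -> G B -> G C -> G (B `&` C).
Proof.
move=> sG; rewrite -[X in X _ -> X _ -> X _](sub_sigma_field_measurableE sG).
exact: measurableI.
Qed.

Lemma sub_sigma_field_generated (I : Type) (H : I -> set (set T)) :
  (forall i, sub_sigma_field (H i)) -> sub_sigma_field <<s \bigcup_i H i>>.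
Proof.
move=> sH; split; first exact: smallest_sigma_algebra.
apply: smallest_sub; first exact: sigma_algebra_measurable.
by move=> B [i _ /(sH i).2].
Qed.

Lemma measurable_sub_sigma_field_id G : sub_sigma_field G ->
  measurable_fun [set: T] (id : T -> g_sigma_algebraType G).
Proof.
move=> sG _ B; rewrite setTI sub_sigma_field_measurableE//.
by case: sG => _; exact.
Qed.

End SubSigmaFields.

(** * Uniqueness and existence of conditional expectations *)

Section ConditionalExpectation.
Local Open Scope ereal_scope.
Context (d : measure_display) (T : measurableType d) (R : realType).
Variable P : probability T R.
Implicit Types (G : set (set T)) (X Y : T -> R).

(** This is the restriction of [P] to [G], encoded as the image of [P] under the identity so that it
    is a probability on a measurable type. *)
Definition trace_measure G (sG : sub_sigma_field G) :
    probability (g_sigma_algebraType G) R :=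
  distribution P (mfun_Sub (mem_set (measurable_sub_sigma_field_id sG))).

Lemma integral_trace_measure G (sG : sub_sigma_field G)
    (f : g_sigma_algebraType G -> \bar R) B :
  measurable_fun [set: g_sigma_algebraType G] f -> G B ->
  \int[trace_measure sG]_(w in B) f w = \int[P]_(w in B) f w.
Proof.
move=> mf GB.
have mB : measurable (B : set (g_sigma_algebraType G)).
  by rewrite sub_sigma_field_measurableE.
have mid := measurable_sub_sigma_field_id sG.
rewrite [LHS]integralE [RHS]integralE.
by congr (_ - _); rewrite [LHS]ge0_integral_pushforward//;
  apply: measurable_funTS; [exact: measurable_funepos|exact: measurable_funeneg].
Qed.

(** Since [is_cond_exp] does not provide integrability, the versions are compared on the sets [D k]
    where both are bounded by [k]. There they are integrable with equal integrals over all sets of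
    [G], and the [D k] exhaust the space. *)
Lemma is_cond_exp_unique G X Y Y' : sub_sigma_field G ->
  is_cond_exp P G X Y -> is_cond_exp P G X Y' ->
  {ae P, forall w, Y w = Y' w}.
Proof.
move=> sG [GY YX] [GY' Y'X].
pose P' := trace_measure sG.
have mY := iffLR (wrt_measurableP Y sG) GY.
have mY' := iffLR (wrt_measurableP Y' sG) GY'.
pose D (k : nat) : set (g_sigma_algebraType G) :=
  [set w | (`|Y w| <= k%:R)%R] `&` [set w | (`|Y' w| <= k%:R)%R].
have mle (Z : T -> R) (k : nat) : measurable_fun [set: g_sigma_algebraType G] Z ->
    measurable ([set w | (`|Z w| <= k%:R)%R] : set (g_sigma_algebraType G)).
  move=> mZ; rewrite -[X in measurable X]setTI; apply: measurable_fun_le => //.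
  by apply: measurableT_comp => //; exact: normr_measurable.
have mD k : measurable (D k) by apply: measurableI; exact: mle.
have intZ (Z : T -> R) k : measurable_fun [set: g_sigma_algebraType G] Z ->
    (forall w, D k w -> (`|Z w| <= k%:R)%R) -> P'.-integrable (D k) (EFin \o Z).
  move=> mZ Zk; apply: (@le_integrable _ _ _ _ _ _ _ (cst k%:R%:E)) => //.
  - by apply/measurable_EFinP; exact: measurable_funTS.
  - by move=> w Dw; rewrite /= lee_fin (le_trans (Zk _ Dw))// ler_norm.
  - exact: finite_measure_integrable_cst.
have ae_eqD k : ae_eq P' (D k) (EFin \o Y) (EFin \o Y').
  apply: integral_ae_eq => //.
  - by apply: intZ => // w [].
  - by apply/measurable_EFinP; exact: measurable_funTS.
  move=> E _ mE; have GE : G E by rewrite -(sub_sigma_field_measurableE sG).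
  rewrite !integral_trace_measure//; try exact/measurable_EFinP.
  by rewrite YX// Y'X.
have [N [mN PN0 subN]] := ae_foralln ae_eqD.
exists N; split => //.
- by move: mN; rewrite sub_sigma_field_measurableE//; have [_] := sG; exact.
apply: subset_trans subN => w /= YY' DY; apply: YY'.
pose k := Num.bound (`|Y w| + `|Y' w|)%R.
have Hk : (`|Y w| + `|Y' w| <= k%:R)%R.
  by rewrite ltW// /k; apply: le_lt_trans (archi_boundP _); rewrite ?addr_ge0.
suff Dw : D k w by have := DY k Dw => -[].
by split => /=; apply: le_trans Hk; rewrite ?lerDl ?lerDr.
Qed.

(** The version is the Radon-Nikodym derivative, on [G], of the signed measure with density [X] with
    respect to the restriction of [P]. *)
Lemma is_cond_exp_exists G X : sub_sigma_field G ->
  P.-integrable [set: T] (EFin \o X) -> exists Y, is_cond_exp P G X Y.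
Proof.
move=> sG intX; pose P' := trace_measure sG.
have mid := measurable_sub_sigma_field_id sG.
pose nu_of : {charge set (g_sigma_algebraType G) -> \bar R} :=
  pushforward (induced_charge intX) (id : T -> g_sigma_algebraType G).
pose nu := nu_of mid.
have nuP' : nu `<< P'.
  apply/null_content_dominatesP => B mB PB0.
  have GB : G B by rewrite -(sub_sigma_field_measurableE sG).
  apply: null_set_integral => //; first by have [_] := sG; exact.
  by apply: measurable_funTS; exact: measurable_int intX.
pose f := Radon_Nikodym nu P'.
have mf : measurable_fun [set: g_sigma_algebraType G] f.
  exact: measurable_int (Radon_Nikodym_integrable nuP').
have ffin w : f w \is a fin_num by exact: Radon_Nikodym_fin_num.
exists (fine \o f); split.
  by apply/wrt_measurableP => //; exact: measurableT_comp.
move=> B GB.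
have mB : measurable (B : set (g_sigma_algebraType G)).
  by rewrite sub_sigma_field_measurableE.
transitivity (nu B); last by [].
rewrite (Radon_Nikodym_integral nuP' mB) integral_trace_measure//.
by apply: eq_integral => w _; rewrite /= fineK.
Qed.

End ConditionalExpectation.

Section ConditionalExpectationTheory.
Local Open Scope ereal_scope.
Context (d : measure_display) (T : measurableType d) (R : realType).
Variable P : probability T R.
Implicit Types (G : set (set T)) (X Y Z : T -> R).

Lemma integral_indicE (B : set T) (f : T -> R) :
  \int[P]_(w in B) (f w)%:E = \int[P]_w (\1_B w * f w)%:E.
Proof.
rewrite integral_mkcond; apply: eq_integral => w _.
by rewrite epatch_indic /= -EFinM mulrC.
Qed.

Lemma ae_eq_integral_EFin (f g : T -> R) (B : set T) :
  measurable B -> measurable_fun [set: T] f -> measurable_fun [set: T] g ->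
  {ae P, forall w, f w = g w} ->
  \int[P]_(w in B) (f w)%:E = \int[P]_(w in B) (g w)%:E.
Proof.
move=> mB mf mg fg; apply: ae_eq_integral => //.
- by apply/measurable_EFinP; exact: measurable_funTS.
- by apply/measurable_EFinP; exact: measurable_funTS.
- by apply: filterS fg => w -> _.
Qed.

Lemma cond_expP G X : sub_sigma_field G ->
  P.-integrable [set: T] (EFin \o X) -> is_cond_exp P G X (cond_exp P G X).
Proof. by move=> sG /(is_cond_exp_exists sG) ex; exact: (xgetPex _ ex). Qed.

(** Both variables have the same set of versions, from which [xget] chooses the same element. Hence
    the equality holds everywhere, and not only almost surely. *)
Lemma cond_exp_ae_eq G X X' : sub_sigma_field G ->
  measurable_fun [set: T] X -> measurable_fun [set: T] X' ->
  {ae P, forall w, X w = X' w} -> cond_exp P G X = cond_exp P G X'.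
Proof.
move=> [_ Gm] mX mX' XX'; congr (xget _ _); apply/seteqP.
split=> Y [GY YX]; split=> // B GB; rewrite YX//;
  apply: ae_eq_integral_EFin => //; try exact: Gm.
by apply: filterS XX' => w ->.
Qed.

Lemma is_cond_exp_aer G X Y Y' : sub_sigma_field G -> is_cond_exp P G X Y ->
  wrt_measurable G Y' -> {ae P, forall w, Y w = Y' w} -> is_cond_exp P G X Y'.
Proof.
move=> sG [GY YX] GY' YY'; split=> // B GB; rewrite -YX//.
have [_ Gm] := sG; apply: ae_eq_integral_EFin => //; try exact: Gm.
- exact: wrt_measurable_fun GY'.
- exact: wrt_measurable_fun GY.
- by apply: filterS YY' => w ->.
Qed.

(** The event where [Y] is negative belongs to [G]. The integral of the absolute value of [Y] over
    it is minus that of [X], hence zero, so the event is null. *)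
Lemma is_cond_exp_ge0 G X Y : sub_sigma_field G -> (forall w, 0 <= X w)%R ->
  is_cond_exp P G X Y -> {ae P, forall w, 0 <= Y w}%R.
Proof.
move=> sG X0 [GY YX]; have [_ Gm] := sG.
have mY := wrt_measurable_fun sG GY.
pose B := ~` [set w | 0 <= Y w]%R.
have GB : G B.
  apply: sub_sigma_fieldC => //; apply: wrt_measurable_le => //.
  by apply/wrt_measurableP => //; exact: measurable_cst.
have Blt w : B w -> (Y w < 0)%R by rewrite ltNge => /negP.
have : \int[P]_(w in B) `|(Y w)%:E| = 0.
  apply/eqP; rewrite eq_le integral_ge0 ?andbT//.
  rewrite -oppe_ge0 -integral_ge0N//.
  under eq_integral => w /set_mem/Blt Yw.
    rewrite abse_EFin ltr0_norm// EFinN oppeK; over.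
  by rewrite YX// integral_ge0// => w _; rewrite lee_fin.
move/(ae_eq_integral_abs _ (Gm _ GB)) => /(_ _) [].
  by apply/measurable_EFinP; exact: measurable_funTS.
move=> N [mN PN sN]; exists N; split=> //.
apply: subset_trans sN => w /= Yw YB.
have Bw : B w by [].
by have := Blt w Bw; case: (YB Bw) => ->; rewrite ltxx.
Qed.

Lemma is_cond_exp_funrpos G X Y : sub_sigma_field G -> (forall w, 0 <= X w)%R ->
  is_cond_exp P G X Y -> is_cond_exp P G X (fun w => Num.max (Y w) 0%R).
Proof.
move=> sG X0 YX; apply: (is_cond_exp_aer sG YX).
  apply/wrt_measurableP => //; apply: measurable_maxr.
    by apply/wrt_measurableP => //; case: YX.
  exact: measurable_cst.
by apply: filterS (is_cond_exp_ge0 sG X0 YX) => w Yw; rewrite max_l.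
Qed.

Lemma is_cond_exp_integrable G X Y : sub_sigma_field G ->
  (forall w, 0 <= X w)%R -> P.-integrable [set: T] (EFin \o X) ->
  is_cond_exp P G X Y -> P.-integrable [set: T] (EFin \o Y).
Proof.
move=> sG X0 intX YX; have [GY EY] := YX.
have mY := wrt_measurable_fun sG GY.
have [GY' EY'] := is_cond_exp_funrpos sG X0 YX.
apply/integrableP; split; first exact/measurable_EFinP.
have -> : \int[P]_w `|(EFin \o Y) w| = \int[P]_w (Num.max (Y w) 0%R)%:E.
  apply: (@ae_eq_integral_EFin (fun w => `|Y w|)%R) => //.
  - by apply: measurableT_comp => //; exact: normr_measurable.
  - exact: wrt_measurable_fun GY'.
  apply: filterS (is_cond_exp_ge0 sG X0 YX) => w Yw.
  by rewrite /= max_l// ger0_norm.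
rewrite EY'; last exact: sub_sigma_fieldT.
have [_] := integrableP _ _ _ intX; apply: le_lt_trans.
by under [leRHS]eq_integral => w _ do rewrite /= ger0_norm//.
Qed.

(** The indicator of a set of [G] is absorbed into the known factor [Z], and [ge0_integralM_eq]
    applies with the product as weight. The integrals may be infinite, which permits ratios as
    products. *)
Lemma is_cond_expM G X Y Z : sub_sigma_field G ->
  wrt_measurable G Z -> (forall w, 0 <= Z w)%R ->
  measurable_fun [set: T] X -> (forall w, 0 <= X w)%R ->
  (forall w, 0 <= Y w)%R -> is_cond_exp P G X Y ->
  is_cond_exp P G (fun w => Z w * X w)%R (fun w => Z w * Y w)%R.
Proof.
move=> sG GZ Z0 mX X0 Y0 [GY YX]; split.
  by apply/wrt_measurableP => //; apply: measurable_funM; exact/wrt_measurableP.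
move=> B GB; rewrite integral_indicE [RHS]integral_indicE.
under eq_integral do rewrite mulrA.
under [RHS]eq_integral do rewrite mulrA.
apply: (@ge0_integralM_eq _ _ _ _ G (fun w => \1_B w * Z w)%R) => //.
- apply/wrt_measurableP => //; apply: measurable_funM; last exact/wrt_measurableP.
  by apply: measurable_indic; rewrite sub_sigma_field_measurableE.
- by move=> w; rewrite mulr_ge0.
- exact: wrt_measurable_fun GY.
Qed.

End ConditionalExpectationTheory.

(** * Independence *)

Section Independence.
Local Open Scope ereal_scope.
Context (d : measure_display) (T : measurableType d) (R : realType).
Variable P : probability T R.
Implicit Types (f g : T -> R) (m : nat).

Lemma measurable_prod_cond (I : eqType) (s : seq I) (p : pred I) (h : I -> T -> R) :
  (forall i, measurable_fun [set: T] (h i)) ->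
  measurable_fun [set: T] (fun w => \prod_(i <- s | p i) h i w)%R.
Proof.
move=> mh; under eq_fun do rewrite -big_filter.
by apply: measurable_prod.
Qed.

(** The two densities define measures that agree on a pi-system containing the whole space, where
    they are finite by integrability of [f]. Such measures agree on the generated sigma-algebra. *)
Lemma integral_eq_on_pi_system (C : set (set T)) f g :
  C `<=` measurable -> setI_closed C -> C [set: T] ->
  measurable_fun [set: T] f -> (forall w, 0 <= f w)%R ->
  measurable_fun [set: T] g -> (forall w, 0 <= g w)%R ->
  P.-integrable [set: T] (EFin \o f) ->
  (forall B, C B -> \int[P]_(w in B) (f w)%:E = \int[P]_(w in B) (g w)%:E) ->
  forall B, <<s C >> B -> \int[P]_(w in B) (f w)%:E = \int[P]_(w in B) (g w)%:E.
Proof.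
move=> Cm CI CT mf f0 mg g0 intf fg.
have density_measure (h : T -> R) : measurable_fun [set: T] h ->
    (forall w, 0 <= h w)%R -> exists mu : {measure set T -> \bar R},
      mu = (fun B => \int[P]_(w in B) (h w)%:E) :> (set T -> \bar R).
  move=> mh h0; pose mu B := \int[P]_(w in B) (h w)%:E.
  have mu0 : mu set0 = 0 by rewrite /mu integral_set0.
  have mu_ge0 B : 0 <= mu B by apply: integral_ge0 => w _; rewrite lee_fin.
  have mu_sigma : semi_sigma_additive mu.
    apply: semi_sigma_additive_nng_induced; first exact/measurable_EFinP.
    by move=> w; rewrite lee_fin.
  pose muM := isMeasure.Build d T R mu mu0 mu_ge0 mu_sigma.
  by exists (HB.pack mu muM : {measure set T -> \bar R}).
have [[muf mufE] [mug mugE]] := (density_measure f mf f0, density_measure g mg g0).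
move=> B CB; rewrite -[LHS]/((fun B => _) B) -mufE -[RHS]/((fun B => _) B) -mugE.
apply: (@g_sigma_algebra_measure_unique _ _ _ C Cm (fun=> setT)) => //.
- by rewrite bigcup_const.
- by move=> A CA; rewrite mufE mugE fg.
move=> _; rewrite mufE ltey_eq; apply/orP; left.
exact: integrable_fin_num.
Qed.

Lemma indic_bigcap m (B : 'I_m -> set T) w :
  (\prod_(i < m) \1_(B i) w)%R = \1_(\bigcap_i B i) w :> R.
Proof.
rewrite [RHS]indicE; have [Bw|nBw] := boolP (w \in _).
  by rewrite big1// => i _; rewrite indicE mem_set//; move/set_mem: Bw; exact.
have [i nBi] : exists i, ~ B i w.
  by apply/existsNP => allB; move/negP: nBw; apply; apply/mem_set => i _; exact: allB.
by rewrite (bigD1 i)//= indicE memNset// mul0r.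
Qed.

Lemma independent_integral_prod m (G : 'I_m -> set (set T)) (Z : 'I_m -> T -> R) :
  (forall i, sub_sigma_field (G i)) -> independent_families P G ->
  (forall i, wrt_measurable (G i) (Z i)) -> (forall i w, 0 <= Z i w)%R ->
  (forall i, P.-integrable [set: T] (EFin \o Z i)) ->
  \int[P]_w (\prod_(i < m) Z i w)%:E = (\prod_(i < m) fine (\int[P]_w (Z i w)%:E))%:E.
Proof.
move=> sG indG.
(* The claim is clear for indicators; they are replaced by arbitrary functions
   one index at a time. *)
suff main k : forall Z : 'I_m -> T -> R,
    (forall i : 'I_m, (k <= i)%N -> exists2 B, G i B & Z i = \1_B) ->
    (forall i, wrt_measurable (G i) (Z i)) -> (forall i w, 0 <= Z i w)%R ->
    (forall i, P.-integrable [set: T] (EFin \o Z i)) ->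
    \int[P]_w (\prod_(i < m) Z i w)%:E =
    (\prod_(i < m) fine (\int[P]_w (Z i w)%:E))%:E.
  by apply: (main m) => i; rewrite leqNgt ltn_ord.
have Gm i := (sG i).2.
elim: k => [|k IH] {}Z Zk GZ Z0 intZ.
  have /choice[B BP] (i : 'I_m) : exists B, G i B /\ Z i = \1_B.
    by have [B GB ->] := Zk i (leq0n i); exists B.
  have mB i : measurable (B i) by apply: Gm; exact: (BP i).1.
  under eq_integral do under eq_bigr do rewrite (BP _).2.
  under eq_integral do rewrite indic_bigcap.
  rewrite integral_indic//; last exact: fin_bigcap_measurable.
  have capE : \bigcap_i B i = \bigcap_(i in [set` [set: 'I_m]%SET]) B i.
    by apply/seteqP; split=> w Bw i _; apply: Bw => //=; rewrite finset.inE.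
  rewrite setIT capE; apply: etrans (indG _ _ (fun i _ => (BP i).1)) _.
  rewrite -[RHS]prodEFin; apply: eq_big => [i|i _]; first by rewrite finset.inE.
  by rewrite (BP i).2 integral_indic// setIT fineK// fin_num_measure.
have [km|mk] := ltnP k m; last first.
  by apply: IH => // i; rewrite leqNgt (leq_trans (ltn_ord i)).
pose i0 := Ordinal km.
have sF := sG i0.
have mZ i : measurable_fun [set: T] (Z i) by exact: wrt_measurable_fun (GZ i).
under eq_integral do rewrite (bigD1 i0)//=.
(* The product of the other factors integrates over [B] in [G i0] to [c] times the probability of
   [B]: this is the induction hypothesis with the indicator of [B] in place of [Z i0]. So that
   product may be replaced by [c] under the weight [Z i0]. *)
pose c := (\prod_(i < m | i != i0) fine (\int[P]_w (Z i w)%:E))%R.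
have c0 : (0 <= c)%R.
  by apply: prodr_ge0 => i _; rewrite fine_ge0// integral_ge0// => w _; rewrite lee_fin.
rewrite (@ge0_integralM_eq _ _ _ _ (G i0) _ _ (cst c))//; last 3 first.
- exact: measurable_prod_cond.
- by move=> w; apply: prodr_ge0.
- move=> B GB; have mB := Gm _ _ GB.
  pose Z' i := if i == i0 then \1_B : T -> R else Z i.
  have -> : \int[P]_(w in B) (\prod_(i < m | i != i0) Z i w)%:E =
      \int[P]_w (\prod_(i < m) Z' i w)%:E.
    rewrite integral_indicE; apply: eq_integral => w _.
    rewrite [in RHS](bigD1 i0)//= /Z' eqxx; congr (_ * _)%:E.
    by apply: eq_bigr => i /negbTE ->.
  rewrite IH.
  + rewrite (bigD1 i0)//= /Z' eqxx integral_indic// setIT.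
    rewrite integral_cst// EFinM fineK ?fin_num_measure// muleC; congr (_%:E * _).
    by apply: eq_bigr => i /negbTE ->.
  + move=> i ki; rewrite /Z'; case: eqP => [->|/eqP ii0]; first by exists B.
    apply: Zk; rewrite ltn_neqAle ki andbT; apply: contra ii0 => /eqP ki'.
    by apply/eqP/val_inj.
  + move=> i; rewrite /Z'; case: eqP => [->|//].
    apply/wrt_measurableP => //; apply: measurable_indic.
    by rewrite sub_sigma_field_measurableE.
  + by move=> i w; rewrite /Z'; case: eqP.
  + by move=> i; rewrite /Z'; case: eqP => // _; exact: integrable_indic.
under eq_integral do rewrite mulrC EFinM.
rewrite ge0_integralZl_EFin//; last 2 first.
- by move=> w _; rewrite lee_fin.
- exact/measurable_EFinP.
rewrite (bigD1 i0)//= mulrC EFinM fineK//.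
exact: (integrable_fin_num measurableT (intZ i0)).
Qed.

End Independence.

(** * Conditional expectation of a product of independent factors *)

Section ConditionalExpectationProduct.
Local Open Scope ereal_scope.
Context (d : measure_display) (T : measurableType d) (R : realType).
Variable P : probability T R.
Variables (m : nat) (G : 'I_m -> set (set T)).
Hypotheses (sG : forall i, sub_sigma_field (G i)).
Hypothesis indG : independent_families P G.

Lemma independent_integrable_prod (Z : 'I_m -> T -> R) :
  (forall i, wrt_measurable (G i) (Z i)) -> (forall i w, 0 <= Z i w)%R ->
  (forall i, P.-integrable [set: T] (EFin \o Z i)) ->
  P.-integrable [set: T] (EFin \o (fun w => \prod_(i < m) Z i w)%R).
Proof.
move=> GZ Z0 intZ; apply/integrableP; split.
  apply/measurable_EFinP; apply: measurable_prod => i _.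
  exact: wrt_measurable_fun (GZ i).
under eq_integral => w _ do rewrite /= ger0_norm ?prodr_ge0//.
by rewrite (independent_integral_prod sG) ?ltry.
Qed.

(** The intersections of one set from each [H i] form a pi-system [C] generating the joint
    sigma-field. Over such an intersection both integrals factor by independence, and the factors
    agree one by one. *)
Lemma is_cond_exp_prod (H : 'I_m -> set (set T)) (Z Y : 'I_m -> T -> R) :
  (forall i, sub_sigma_field (H i)) -> (forall i, H i `<=` G i) ->
  (forall i, wrt_measurable (G i) (Z i)) -> (forall i w, 0 <= Z i w)%R ->
  (forall i, P.-integrable [set: T] (EFin \o Z i)) ->
  (forall i w, 0 <= Y i w)%R -> (forall i, is_cond_exp P (H i) (Z i) (Y i)) ->
  is_cond_exp P <<s \bigcup_i H i>> (fun w => \prod_(i < m) Z i w)%R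
    (fun w => \prod_(i < m) Y i w)%R.
Proof.
move=> sH HG GZ Z0 intZ Y0 YZ.
have sF := sub_sigma_field_generated sH.
have HY i : wrt_measurable (H i) (Y i) by case: (YZ i).
have GY i : wrt_measurable (G i) (Y i) by exact: wrt_measurable_sub (HG i) _.
have intY i : P.-integrable [set: T] (EFin \o Y i).
  exact: is_cond_exp_integrable (sH i) (Z0 i) (intZ i) (YZ i).
split.
  apply: wrt_measurable_prod => // i; apply: wrt_measurable_sub (HY i).
  by move=> B HB; apply: sub_sigma_algebra; exists i.
pose C := [set D | exists2 B, (forall i, H i (B i)) & D = \bigcap_i B i].
move=> B FB; apply: (@integral_eq_on_pi_system _ _ _ _ C).
- move=> _ [D HD ->]; apply: fin_bigcap_measurable => // i _.
  exact: (sH i).2.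
- move=> _ _ [D HD ->] [E HE ->]; exists (fun i => D i `&` E i).
    by move=> i; exact: sub_sigma_fieldI.
  by rewrite bigcapI.
- exists (fun=> setT); first by move=> i; exact: sub_sigma_fieldT.
  by rewrite bigcapT.
- by apply: measurable_prod => i _; exact: wrt_measurable_fun (GY i).
- by move=> w; exact: prodr_ge0.
- by apply: measurable_prod => i _; exact: wrt_measurable_fun (GZ i).
- by move=> w; exact: prodr_ge0.
- exact: independent_integrable_prod.
- move=> _ [D HD ->].
  have GD i : G i (D i) by exact: HG.
  have mD i := (sG i).2 _ (GD i).
  have intE (V : 'I_m -> T -> R) : (forall i, wrt_measurable (G i) (V i)) ->
      (forall i w, 0 <= V i w)%R ->
      (forall i, P.-integrable [set: T] (EFin \o V i)) ->
      \int[P]_(w in \bigcap_i D i) (\prod_(i < m) V i w)%:E =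
      (\prod_(i < m) fine (\int[P]_(w in D i) (V i w)%:E))%:E.
    move=> GV V0 intV; rewrite integral_indicE.
    under eq_integral do rewrite -indic_bigcap -big_split/=.
    under [in RHS]eq_bigr do rewrite integral_indicE.
    apply: (independent_integral_prod sG indG) => [i|i w|i].
    + apply/wrt_measurableP => //; apply: measurable_funM; last exact/wrt_measurableP.
      by apply: measurable_indic; rewrite sub_sigma_field_measurableE.
    + by rewrite mulr_ge0.
    + apply: (le_integrable _ _ _ (intV i)) => //.
      * apply/measurable_EFinP; apply: measurable_funM;
          last exact: wrt_measurable_fun (GV i).
        exact: measurable_indic.
      * move=> w _; rewrite /= lee_fin normrM ler_piMl// indicE.
        by case: (_ \in _); rewrite ?normr1 ?normr0.
  rewrite !intE//; congr (_%:E); apply: eq_bigr => i _.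
  by have [_ ->] := YZ i.
(* A set of [H i] is the intersection in [C] whose other members are the whole space. *)
- suff : <<s \bigcup_i H i>> `<=` <<s C>> by exact.
  apply: smallest_sub; first exact: smallest_sigma_algebra.
  move=> D [i _ HD]; apply: sub_sigma_algebra.
  exists (fun j => if j == i then D else setT).
    by move=> j; case: eqP => [->//|_]; exact: sub_sigma_fieldT.
  apply/seteqP; split=> [w Dw j _|w /(_ i I)]; last by rewrite eqxx.
  by case: eqP.
Qed.

End ConditionalExpectationProduct.

(** * Stopping in the monotone case *)

Section FirstTime.
Implicit Types p q : pred nat.

Lemma first_timeP p n : first_time p = Some n <->
  [/\ (0 < n)%N, p n & forall k, (0 < k)%N -> (k < n)%N -> ~~ p k].
Proof.
rewrite /first_time; case: pselect => [ex|nex]; last first.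
  by split=> // -[n0 pn _]; case: nex; exists n; rewrite n0.
case: ex_minnP => k /andP[k0 pk] kmin; split=> [[<-]|[n0 pn nmin]].
  split=> // j j0 jk; apply/negP => pj.
  by have := kmin j; rewrite j0 pj leqNgt jk => /(_ isT).
congr Some; apply/eqP; rewrite eqn_leq kmin ?n0//= leqNgt.
by apply/negP => /(nmin _ k0)/negP.
Qed.

Lemma first_timeN p : first_time p = None <-> forall n, (0 < n)%N -> ~~ p n.
Proof.
rewrite /first_time; case: pselect => [ex|nex]; split=> //.
  by case: ex_minnP => k /andP[k0 pk] _ /(_ k k0); rewrite pk.
by move=> _ n n0; apply/negP => pn; apply: nex; exists n; rewrite n0.
Qed.

Lemma eq_first_time p q : (forall n, (0 < n)%N -> p n = q n) ->
  first_time p = first_time q.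
Proof.
move=> pq; case E : (first_time q) => [n|].
  move/first_timeP: E => [n0 qn qmin]; apply/first_timeP; split=> //.
    by rewrite pq.
  by move=> k k0 kn; rewrite pq// qmin.
by move/first_timeN: E => qN; apply/first_timeN => n n0; rewrite pq// qN.
Qed.

(** The left side has the shape of [stop_after] below. By strong induction, a [k] up to [L]
    satisfying [p] would be the first one. *)
Lemma first_time_gt p L : (forall k, (k < L.+1)%N -> first_time p <> Some k) <->
  (forall k, (0 < k)%N -> (k <= L)%N -> ~~ p k).
Proof.
split=> [H k|H k kL /first_timeP[k0 pk _]]; last first.
  by move/negP: (H k k0 kL).
elim/ltn_ind: k => k IH k0 kL; apply/negP => pk.
apply: (H k) => //; apply/first_timeP; split=> // j j0 jk.
by apply: IH => //; rewrite (leq_trans (ltnW jk)).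
Qed.

End FirstTime.

(** * Truncated stopping times and stopped variables *)

Section Stopping.
Local Open Scope ereal_scope.
Context (d : measure_display) (T : measurableType d) (R : realType).
Implicit Types (X : nat -> T -> R) (tau : T -> option nat).

(** This is the event that [tau] exceeds [L], infinity included. As a finite intersection of
    complements of [{tau = k}] it is visibly known at time [L]. *)
Definition stop_after tau L : set T :=
  [set w | forall k, (k < L.+1)%N -> tau w <> Some k].

(** The truncated time is always finite, so the stopped variable has this real-valued form. *)
Definition stopped_at X tau L (w : T) : R :=
  X (if tau w is Some n then minn n L else L) w.

Lemma stopped_min_time X tau L w :
  stopped X (min_time tau L) w = (stopped_at X tau L w)%:E.
Proof. by rewrite /stopped /min_time /stopped_at; case: (tau w). Qed.

Lemma stopped_atS X tau L w : stopped_at X tau L.+1 w =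
  (stopped_at X tau L w + \1_(stop_after tau L) w * (X L.+1 w - X L w))%R.
Proof.
rewrite /stopped_at indicE; case E : (tau w) => [n|]; last first.
  by rewrite mem_set ?mul1r ?subrKC// => k _; rewrite E.
have [nL|Ln] := leqP n L.
  rewrite memNset ?mul0r ?addr0; last by move=> /(_ n nL).
  by rewrite (minn_idPl (leqW nL)).
rewrite mem_set ?mul1r; last first.
  by move=> k kL; rewrite E => -[nk]; rewrite nk ltnNge -ltnS kL in Ln.
by rewrite (minn_idPr Ln) subrKC.
Qed.

(** Where [tau] is finite the truncations are eventually constant; where it is infinite they run
    through the sequence itself, whose lower limit is the convention for the value at infinity.
    Measurability and Fatou's lemma both start from this identity. *)
Lemma stopped_limn_einf X tau w :
  stopped X tau w = limn_einf (fun L => stopped X (min_time tau L) w).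
Proof.
rewrite /stopped /min_time; case: (tau w) => [n|//].
apply/esym/(fun h => (cvg_limn_einf_sup h).1).
apply: cvg_near_cst; exists n => // L /= nL.
by rewrite (minn_idPl nL).
Qed.

Lemma measurable_stopped_at X tau L : (forall n, measurable_fun [set: T] (X n)) ->
  (forall n, measurable (stop_after tau n)) ->
  measurable_fun [set: T] (stopped_at X tau L).
Proof.
move=> mX mtau; elim: L => [|L IH].
  have -> : stopped_at X tau 0 = X 0%N; last exact: mX.
  by apply/funext => w; rewrite /stopped_at; case: (tau w) => // n; rewrite minn0.
rewrite (funext (stopped_atS X tau L)).
apply: measurable_funD => //; apply: measurable_funM; first exact: measurable_indic.
exact: measurable_funB.
Qed.

Lemma measurable_stopped X tau : (forall n, measurable_fun [set: T] (X n)) ->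
  (forall n, measurable (stop_after tau n)) ->
  measurable_fun [set: T] (stopped X tau).
Proof.
move=> mX mtau; rewrite (funext (stopped_limn_einf X tau)).
rewrite /limn_einf; apply: measurableT_comp => //.
apply: measurable_fun_limn_esup => L; apply: measurableT_comp => //.
rewrite (funext (stopped_min_time X tau L)).
by apply/measurable_EFinP; exact: measurable_stopped_at.
Qed.

Lemma sub_sigma_field_forall_lt (G : set (set T)) (Q : nat -> set T) n :
  sub_sigma_field G -> (forall k, (k < n)%N -> G (Q k)) ->
  G [set w | forall k, (k < n)%N -> Q k w].
Proof.
move=> sG GQ; rewrite -[X in X _](sub_sigma_field_measurableE sG).
apply: (@fin_bigcap_measurable _ (g_sigma_algebraType G) _ `I_n Q) => //.
by move=> k /= kn; rewrite sub_sigma_field_measurableE//; exact: GQ.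
Qed.

End Stopping.

(** * Optimality of the myopic rule for nonnegative monotone case problems *)

Section MonotoneCase.
Local Open Scope ereal_scope.
Context (d : measure_display) (T : measurableType d) (R : realType).
Variable P : probability T R.
Variables (F : nat -> set (set T)) (X : nat -> T -> R).
Hypothesis sF : forall n, sub_sigma_field (F n).
Hypothesis F_mono : forall n k, (n <= k)%N -> F n `<=` F k.
Hypothesis mX : forall n, measurable_fun [set: T] (X n).
Hypothesis X_ge0 : forall n, {ae P, forall w, 0 <= X n w}%R.
Hypothesis X_mono : monotone_case P F X.

Let tau := myopic_time P F X.
Let intX n : (0 < n)%N -> P.-integrable [set: T] (EFin \o X n).
Proof. by move=> n0; case: X_mono => _ /(_ n n0). Qed.

Let C n := cond_exp P (F n) (X n.+1).

Let CP n : is_cond_exp P (F n) (X n.+1) (C n).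
Proof. by apply: cond_expP => //; exact: intX. Qed.

Let intC n : P.-integrable [set: T] (EFin \o C n).
Proof.
(* [X n.+1] is nonnegative only almost surely. Its positive part is nonnegative everywhere and has
   literally the same [cond_exp]. *)
pose V w := Num.max (X n.+1 w) 0%R.
have mV : measurable_fun [set: T] V.
  by apply: measurable_maxr => //; exact: measurable_cst.
have XV : {ae P, forall w, X n.+1 w = V w}.
  by apply: filterS (X_ge0 n.+1) => w Xw; rewrite /V max_l.
have V0 w : (0 <= V w)%R by rewrite /V le_max lexx orbT.
have intV : P.-integrable [set: T] (EFin \o V).
  apply: (le_integrable measurableT _ _ (intX (ltn0Sn n))).
    exact/measurable_EFinP.
  move=> w _; rewrite /= lee_fin ger0_norm// /V ge_max ler_norm//=.
have := CP n; rewrite /C (cond_exp_ae_eq (sF n) _ mV XV)// => _.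
by apply: (is_cond_exp_integrable (sF n) V0 intV); exact: cond_expP.
Qed.

Lemma stop_after_sub sigma L : stopping_time F sigma -> F L (stop_after sigma L).
Proof.
move=> [sigma0 Fsigma].
apply: (@sub_sigma_field_forall_lt _ _ _ (fun k => [set w | sigma w <> Some k])) => //.
(* Index 0 is excluded by the range of a stopping time; the other events are known at time [k.+1],
   hence at time [L]. *)
move=> [_|k kL].
  rewrite (_ : [set w | _] = setT); first exact: sub_sigma_fieldT.
  by apply/seteqP; split=> // w _ /=; exact: sigma0.
by apply: (F_mono (kL : (k.+1 <= L)%N)); apply: sub_sigma_fieldC => //; exact: Fsigma.
Qed.

Lemma measurable_stop_after sigma L : stopping_time F sigma ->
  measurable (stop_after sigma L).
Proof. by move=> /(stop_after_sub L); exact: (sF L).2. Qed.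

Lemma myopic_stopping_time : stopping_time F tau.
Proof.
pose E k := [set w | C k w <= X k w]%R.
have FE k : (0 < k)%N -> F k (E k).
  move=> k0; apply: wrt_measurable_le => //; first by case: (CP k).
  by case: X_mono => + _ _; exact.
split=> [w /first_timeP[]//|n n0].
rewrite (_ : [set w | _] = E n `&`
    [set w | forall k, (k < n)%N -> ((0 < k)%N -> ~ E k w)]); last first.
  apply/seteqP; split=> w /=.
    move=> /first_timeP[_ En nE]; split=> // k kn k0.
    by apply/negP; exact: nE.
  move=> [En nE]; apply/first_timeP; split=> // k k0 kn.
  by apply/negP; exact: nE.
apply: sub_sigma_fieldI => //; first exact: FE.
apply: (@sub_sigma_field_forall_lt _ _ _ (fun k => [set w | (0 < k)%N -> ~ E k w])) => //.
case=> [|k] kn.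
  rewrite (_ : [set w | _] = setT); first exact: sub_sigma_fieldT.
  by apply/seteqP; split.
rewrite (_ : [set w | _] = ~` E k.+1); last first.
  by apply/seteqP; split=> w /=; [exact|move=> ? _].
by apply: sub_sigma_fieldC => //; apply: (F_mono (ltnW kn)); exact: FE.
Qed.

(** Outside one null set serving all [n], the inequality defining the myopic rule persists once it
    holds. If it fails at [L], it therefore fails at every earlier index. *)
Let stop_after_myopic L : (0 < L)%N ->
  {ae P, forall w, stop_after tau L w <-> (X L w < C L w)%R}.
Proof.
move=> L0; have [_ _ mono] := X_mono.
have : {ae P, forall w, forall n, (0 < n)%N ->
    (C n w <= X n w -> C n.+1 w <= X n.+1 w)%R}.
  apply: ae_foralln => -[|n]; first by apply: aeW.
  by apply: filterS (mono n.+1 (ltn0Sn n)) => w + _.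
apply: filterS => w {}mono; split.
  move=> /first_time_gt/(_ L L0 (leqnn L)).
  by rewrite -ltNge.
rewrite ltNge => /negP nCL; apply/first_time_gt => k k0 kL.
apply/negP => Ck; apply: nCL; rewrite -(subnKC kL).
elim: (L - k)%N => [|j IH]; first by rewrite addn0.
by rewrite addnS; apply: mono => //; rewrite addn_gt0 k0.
Qed.

Let increment sigma L := \int[P]_(w in stop_after sigma L) (X L.+1 w - X L w)%:E.

(** The event [stop_after sigma L] lies in [F L], so [X L.+1] may be replaced by its conditional
    expectation there. *)
Let increment_cond sigma L : stopping_time F sigma -> (0 < L)%N ->
  increment sigma L = \int[P]_w (\1_(stop_after sigma L) w * (C L w - X L w))%:E.
Proof.
move=> st L0; have FA := stop_after_sub L st.
have mA := measurable_stop_after L st.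
have intA f : P.-integrable [set: T] f -> P.-integrable (stop_after sigma L) f.
  by apply: integrableS.
rewrite -integral_indicE /increment.
under eq_integral do rewrite EFinB.
under [RHS]eq_integral do rewrite EFinB.
rewrite integralB//; [|exact/intA/intX..].
rewrite integralB//; [|exact/intA/intC|exact/intA/intX].
by have [_ ->] := CP L.
Qed.

Let h L w := (C L w - X L w)%R.

Let inth L : (0 < L)%N -> P.-integrable [set: T] (EFin \o h L).
Proof.
move=> L0.
by have := integrableB measurableT (intC L) (intX L0).
Qed.

Let mh L : (0 < L)%N -> measurable_fun [set: T] (h L).
Proof. by move=> /inth/measurable_int/measurable_EFinP. Qed.

(** The myopic rule continues exactly where [h L] is positive, so its gain is the integral of the
    positive part, the largest that any event can give. *)
Let increment_myopic L : (0 < L)%N ->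
  increment tau L = \int[P]_w (Num.max (h L w) 0%R)%:E.
Proof.
move=> L0; have st := myopic_stopping_time.
rewrite increment_cond//.
apply: ae_eq_integral_EFin => //.
- apply: measurable_funM; last exact: mh.
  by apply: measurable_indic; exact: measurable_stop_after.
- by apply: measurable_maxr; [exact: mh|exact: measurable_cst].
apply: filterS (stop_after_myopic L0) => w tauw; rewrite indicE.
have [/set_mem/tauw|] := boolP (w \in _).
  by rewrite mul1r -subr_gt0 => /ltW/max_l.
rewrite notin_setE => ntau; rewrite mul0r max_r// /h subr_le0 leNgt.
by apply/negP => /tauw.
Qed.

Let increment_myopic_ge0 L : (0 < L)%N -> 0 <= increment tau L.
Proof.
move=> L0; rewrite increment_myopic//; apply: integral_ge0 => w _.
by rewrite lee_fin le_max lexx orbT.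
Qed.

Let increment_le sigma L : stopping_time F sigma -> (0 < L)%N ->
  increment sigma L <= increment tau L.
Proof.
move=> st L0; rewrite increment_cond// increment_myopic//.
have mA := measurable_stop_after L st.
apply: le_integral => //.
- apply: (le_integrable measurableT _ _ (inth L0)).
    apply/measurable_EFinP; apply: measurable_funM; last exact: mh.
    exact: measurable_indic.
  move=> w _; rewrite /= lee_fin normrM ler_piMl// indicE.
  by case: (_ \in _); rewrite ?normr1 ?normr0.
- apply: (le_integrable measurableT _ _ (inth L0)).
    apply/measurable_EFinP; apply: measurable_maxr; first exact: mh.
    exact: measurable_cst.
  move=> w _; rewrite /= lee_fin ger0_norm ?le_max ?lexx ?orbT//.
  by rewrite ge_max ler_norm normr_ge0.
move=> w _; rewrite lee_fin indicE; case: (_ \in _).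
  by rewrite mul1r le_max lexx.
by rewrite mul0r le_max lexx orbT.
Qed.

Let value sigma L := \int[P]_w stopped X (min_time sigma L) w.

Let integrable_stopped_at sigma L : stopping_time F sigma -> (0 < L)%N ->
  P.-integrable [set: T] (EFin \o stopped_at X sigma L).
Proof.
move=> st; case: L => // L _; elim: L => [|L IH].
  rewrite (_ : stopped_at X sigma 1 = X 1%N); first exact: intX.
  apply/funext => w; rewrite /stopped_at; case E : (sigma w) => [[|n]|] //.
  by have := st.1 w.
have mA := measurable_stop_after L.+1 st.
have : P.-integrable [set: T] (EFin \o (fun w =>
    \1_(stop_after sigma L.+1) w * (X L.+2 w - X L.+1 w))%R).
  apply: (le_integrable measurableT _ _
    (integrableB measurableT (intX (ltn0Sn L.+1)) (intX (ltn0Sn L)))).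
    apply/measurable_EFinP; apply: measurable_funM; first exact: measurable_indic.
    exact: measurable_funB.
  move=> w _; rewrite /= lee_fin normrM ler_piMl// indicE.
  by case: (_ \in _); rewrite ?normr1 ?normr0.
move=> /(integrableD measurableT IH).
by under eq_fun do rewrite /= -EFinD -stopped_atS.
Qed.

Let valueS sigma L : stopping_time F sigma -> (0 < L)%N ->
  value sigma L.+1 = value sigma L + increment sigma L.
Proof.
move=> st L0; have mA := measurable_stop_after L st; rewrite /value.
under eq_integral do rewrite stopped_min_time stopped_atS EFinD.
under [X in _ = X + _]eq_integral do rewrite stopped_min_time.
rewrite /increment [X in _ = _ + X]integral_indicE integralD//.
  exact: integrable_stopped_at.
apply: (le_integrable measurableT _ _
  (integrableB measurableT (intX (ltn0Sn L)) (intX L0))).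
  apply/measurable_EFinP; apply: measurable_funM; first exact: measurable_indic.
  exact: measurable_funB.
move=> w _; rewrite /= lee_fin normrM ler_piMl// indicE.
by case: (_ \in _); rewrite ?normr1 ?normr0.
Qed.

(** At [L = 1] the two values coincide, since no stopping time takes the value 0. Afterwards the
    increments compare termwise. *)
Let value_le sigma L : stopping_time F sigma -> (0 < L)%N ->
  value sigma L <= value tau L.
Proof.
move=> st; case: L => // L _; elim: L => [|L IH].
  rewrite /value le_eqVlt; apply/orP; left; apply/eqP; apply: eq_integral => w _.
  rewrite !stopped_min_time /stopped_at.
  have : tau w <> Some 0%N by have [+ _] := myopic_stopping_time; exact.
  have : sigma w <> Some 0%N by have [+ _] := st; exact.
  by case: (sigma w) => [[|n]|]//; case: (tau w) => [[|n']|].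
rewrite (valueS st (ltn0Sn L)) (valueS myopic_stopping_time (ltn0Sn L)).
by apply: leeD => //; exact: increment_le.
Qed.

Let value_le_limn L : (0 < L)%N -> value tau L <= limn (value tau).
Proof.
(* Monotonicity is established from index 1 on, because [value tau 0] involves the conventional
   [X 0]. The shift does not change the limit. *)
have nd : {homo (fun n => value tau n.+1) : n k / (n <= k)%N >-> n <= k}.
  apply/nondecreasing_seqP => n; rewrite (valueS myopic_stopping_time (ltn0Sn n)).
  by rewrite leeDl// increment_myopic_ge0.
have cvgv := ereal_nondecreasing_cvgn nd.
have : value tau n @[n --> \oo] --> ereal_sup (range (fun n => value tau n.+1)).
  by rewrite -cvg_shiftS.
move=> /cvg_lim -> //; case: L => // L _.
by apply: ereal_sup_ubound; exists L.
Qed.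

(** Fatou's lemma is applied to functions nonnegative everywhere, so [X] is exchanged for its
    absolute value, from which it differs only on a null set. *)
Let stopped_norm sigma :
  {ae P, forall w, stopped X sigma w = stopped (fun n w => `|X n w|%R) sigma w}.
Proof.
have := ae_foralln X_ge0; apply: filterS => w Xw.
rewrite /stopped; case: (sigma w) => [n|]; first by rewrite ger0_norm.
by congr limn_einf; apply/funext => n; rewrite ger0_norm.
Qed.

Let integral_stopped_norm sigma : stopping_time F sigma ->
  \int[P]_w stopped X sigma w =
  \int[P]_w stopped (fun n w => `|X n w|%R) sigma w.
Proof.
move=> st; have mA n := measurable_stop_after n st.
apply: ae_eq_integral => //.
- exact: (measurable_stopped mX mA).
- by apply: measurable_stopped => // n; exact: measurableT_comp.
- by apply: filterS (stopped_norm sigma) => w -> _.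
Qed.

Let stopped_norm_ge0 sigma w : 0 <= stopped (fun n w => `|X n w|%R) sigma w.
Proof.
rewrite /stopped; case: (sigma w) => [n|]; first by rewrite lee_fin.
rewrite limn_einf_lim; apply: lime_ge; first exact: is_cvg_einfs.
by apply: nearW => n; apply: le_ereal_inf_tmp => _ [k _ <-]; rewrite lee_fin.
Qed.

Lemma expectation_exists_stopped sigma : stopping_time F sigma ->
  expectation_exists P (stopped X sigma).
Proof.
move=> st; have mA n := measurable_stop_after n st; right.
suff -> : \int[P]_w (stopped X sigma)^\- w = \int[P]_w cst 0 w by rewrite integral0.
apply: ae_eq_integral => //.
  by apply: measurable_funeneg; exact: (measurable_stopped mX mA).
apply: filterS (stopped_norm sigma) => w Xw _ /=.
by rewrite funenegE Xw max_r// oppe_le0.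
Qed.

Let stopped_le_limn sigma : stopping_time F sigma ->
  \int[P]_w stopped X sigma w <= limn (value tau).
Proof.
move=> st; have mA n := measurable_stop_after n st.
rewrite integral_stopped_norm//.
under eq_integral do rewrite stopped_limn_einf.
have mn n : measurable_fun [set: T] (fun w => `|X n w|%R).
  by apply: measurableT_comp => //; exact: normr_measurable.
apply: le_trans (fatou P measurableT _ _) _.
- move=> L; rewrite (funext (stopped_min_time _ sigma L)).
  by apply/measurable_EFinP; exact: measurable_stopped_at.
- by move=> L w _; exact: stopped_norm_ge0.
(* The lower limit is the limit of the infima over tails. For positive [L] the infimum from [L] on
   is at most its first term, hence at most [value sigma L], then [value tau L], then the limit. *)
rewrite limn_einf_lim; apply: lime_le; first exact: is_cvg_einfs.
exists 1%N => // L /= L0; apply: le_trans (value_le_limn L0).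
apply: le_trans (value_le st L0).
apply: le_trans (ereal_inf_lbound _) _; first by exists L => /=.
rewrite /value le_eqVlt; apply/orP; left; apply/eqP.
apply: ae_eq_integral => //.
- rewrite (funext (stopped_min_time _ sigma L)).
  by apply/measurable_EFinP; exact: measurable_stopped_at.
- rewrite (funext (stopped_min_time _ sigma L)).
  by apply/measurable_EFinP; exact: measurable_stopped_at.
- by apply: filterS (stopped_norm (min_time sigma L)) => w -> _.
Qed.

Lemma monotone_case_optimal :
  limn (fun L => \int[P]_w stopped X (min_time tau L) w) <=
    \int[P]_w stopped X tau w ->
  optimal P F X tau.
Proof.
move=> lim_le; have st := myopic_stopping_time; split=> //.
  exact: expectation_exists_stopped.
apply/eqP; rewrite eq_le; apply/andP; split.
  apply: ereal_sup_ubound; exists tau => //; split=> //.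
  exact: expectation_exists_stopped.
apply: ge_ereal_sup => _ [sigma [st' _] <-].
by apply: le_trans lim_le; exact: stopped_le_limn.
Qed.

End MonotoneCase.

(** * Products of independent sequences *)

Section ConditionalRatio.
Local Open Scope ereal_scope.
Context (d : measure_display) (T : measurableType d) (R : realType).
Variable P : probability T R.

(** On nonnegative numbers the inverse is the power with exponent -1. With the convention that 0 has
    inverse 0, the general inverse is the difference of the inverses of the positive and negative
    parts. *)
Lemma measurable_invr : measurable_fun [set: R] (fun x : R => x^-1%R).
Proof.
have mmax (f : R -> R) : measurable_fun [set: R] f ->
    measurable_fun [set: R] (fun x => (Num.max (f x) 0)^-1%R).
  move=> mf; under eq_fun do rewrite -powR_inv1 ?le_max ?lexx ?orbT//.
  apply: (measurableT_comp (measurable_powR (-1)%R)).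
  by apply: measurable_maxr => //; exact: measurable_cst.
rewrite (_ : (fun _ => _) = (fun x => (Num.max x 0)^-1 - (Num.max (- x) 0)^-1)%R).
  by apply: measurable_funB; apply: mmax => //; exact: oppr_measurable.
apply/funext => x; have [x0|x0] := leP x 0%R.
  by rewrite (max_l (y := 0%R)) ?oppr_ge0// invr0 sub0r invrN opprK.
by rewrite (max_r (x := (- x)%R)) ?oppr_le0 ?ltW// invr0 subr0.
Qed.

Lemma cond_exp_ae G (X Y : T -> R) : sub_sigma_field G ->
  is_cond_exp P G X Y -> {ae P, forall w, cond_exp P G X w = Y w}.
Proof.
move=> sG YX; apply: (is_cond_exp_unique sG _ YX).
exact: (xgetPex _ (ex_intro _ Y YX)).
Qed.

Variables (m : nat) (A : 'I_m -> nat -> set (set T)) (X : 'I_m -> nat -> T -> R).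
Hypothesis A_filtration : forall i, filtration (A i).
Hypothesis A_independent : independent_filtrations P A.
Hypothesis X_adapted : forall i, adapted (A i) (X i).
Hypothesis X_positive : forall i n, (0 < n)%N -> {ae P, forall w, (0 < X i n w)%R}.
Hypothesis X_integrable : forall i n, (0 < n)%N ->
  P.-integrable [set: T] (EFin \o X i n).

Let F := joint_filtration A.
Let G i := <<s \bigcup_n A i n>>.

Let sA i n : sub_sigma_field (A i n).
Proof. by have [+ _ _] := A_filtration i. Qed.

Let AG i n : A i n `<=` G i.
Proof. by move=> B AB; apply: sub_sigma_algebra; exists n. Qed.

Let sG i : sub_sigma_field (G i).
Proof. exact: sub_sigma_field_generated. Qed.

Let AF i n : A i n `<=` F n.
Proof. by move=> B AB; apply: sub_sigma_algebra; exists i. Qed.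

Lemma joint_filtration_sub n : sub_sigma_field (F n).
Proof. exact: sub_sigma_field_generated. Qed.

Lemma joint_filtration_mono n k : (n <= k)%N -> F n `<=` F k.
Proof.
move=> nk; apply: sub_sigma_algebra2 => B [i _ AB]; exists i => //.
by have [_ + _] := A_filtration i; move=> /(_ _ _ nk); exact.
Qed.

Let sF := joint_filtration_sub.

Let mX i n : (0 < n)%N -> measurable_fun [set: T] (X i n).
Proof. by move=> n0; exact: wrt_measurable_fun (X_adapted i n0). Qed.

(* Positivity holds only almost everywhere, while the lemmas on conditional
   expectations want functions that are nonnegative everywhere. *)
Let V i n w := Num.max (X i n w) 0%R.

Let V_ge0 i n w : (0 <= V i n w)%R.
Proof. by rewrite le_max lexx orbT. Qed.

Let AV i n : (0 < n)%N -> wrt_measurable (A i n) (V i n).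
Proof.
move=> n0; apply/wrt_measurableP => //; apply: measurable_maxr.
  exact/wrt_measurableP/X_adapted.
exact: measurable_cst.
Qed.

Let mV i n : (0 < n)%N -> measurable_fun [set: T] (V i n).
Proof. by move=> n0; exact: wrt_measurable_fun (AV i n0). Qed.

Let GV i n : (0 < n)%N -> wrt_measurable (G i) (V i n).
Proof. by move=> n0; exact: wrt_measurable_sub (@AG i n) (AV i n0). Qed.

Let XV i n : (0 < n)%N -> {ae P, forall w, X i n w = V i n w}.
Proof.
by move=> n0; apply: filterS (X_positive i n0) => w /ltW Xw; rewrite /V max_l.
Qed.

Let intV i n : (0 < n)%N -> P.-integrable [set: T] (EFin \o V i n).
Proof.
move=> n0; apply: (le_integrable measurableT _ _ (X_integrable i n0)).
  exact/measurable_EFinP/mV.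
move=> w _; rewrite /= lee_fin ger0_norm// /V ge_max ler_norm//=.
Qed.

Let XprodV n : (0 < n)%N ->
  {ae P, forall w, (\prod_(i < m) X i n w = \prod_(i < m) V i n w)%R}.
Proof.
move=> n0; have : {ae P, forall w, forall i, X i n w = V i n w}.
  by apply: filter_forall => i; exact: XV.
by apply: filterS => w Xw; apply: eq_bigr.
Qed.

Lemma adapted_prod : adapted F (fun n w => \prod_(i < m) X i n w)%R.
Proof.
move=> n n0; apply: wrt_measurable_prod => // i.
exact: wrt_measurable_sub (@AF i n) (X_adapted i n0).
Qed.

Lemma integrable_prod n : (0 < n)%N ->
  P.-integrable [set: T] (EFin \o (fun w => \prod_(i < m) X i n w)%R).
Proof.
move=> n0.
have intp := independent_integrable_prod sG A_independent
  (fun i => @GV i n n0) (fun i => V_ge0 i n) (fun i => intV i n0).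
apply/integrableP; split.
  by apply/measurable_EFinP; exact: wrt_measurable_fun (adapted_prod n0).
have [_] := integrableP _ _ _ intp; congr (_ < _).
apply: ae_eq_integral => //.
- apply: measurableT_comp => //; exact: measurable_int intp.
- apply: measurableT_comp => //; apply/measurable_EFinP.
  exact: wrt_measurable_fun (adapted_prod n0).
- by apply: filterS (XprodV n0) => w /= -> _.
Qed.

(** All terms are expressed through nonnegative versions [Y i] of the conditional expectation of
    [V i n.+1] given [A i n]: the product of the [Y i] serves the product, and [Y i] divided by
    [V i n] serves the ratio. *)
Lemma cond_exp_prod_ratio n : (0 < n)%N -> {ae P, forall w,
  [/\ forall i, (0 <= cond_exp P (F n) (fun w' => X i n.+1 w' / X i n w')%R w)%R,
      (0 < \prod_(i < m) X i n w)%R &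
      cond_exp P (F n) (fun w' => \prod_(i < m) X i n.+1 w')%R w =
      ((\prod_(i < m) cond_exp P (F n) (fun w' => X i n.+1 w' / X i n w') w) *
       \prod_(i < m) X i n w)%R]}.
Proof.
move=> n0.
have /choice[Y YV] (i : 'I_m) : exists Y,
    is_cond_exp P (A i n) (V i n.+1) Y /\ forall w, (0 <= Y w)%R.
  have [Y YV] := is_cond_exp_exists (sA i n) (intV i (ltn0Sn n)).
  exists (fun w => Num.max (Y w) 0%R); split.
    exact: is_cond_exp_funrpos (V_ge0 i n.+1) YV.
  by move=> w; rewrite le_max lexx orbT.
have Y0 i w : (0 <= Y i w)%R by have [_] := YV i; exact.
have {}YV i : is_cond_exp P (A i n) (V i n.+1) (Y i) by have [] := YV i.
have prodY : is_cond_exp P (F n) (fun w => \prod_(i < m) V i n.+1 w)%R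
    (fun w => \prod_(i < m) Y i w)%R.
  apply: (is_cond_exp_prod sG A_independent (H := A^~ n)) => // i.
  - exact: GV.
  - exact: intV.
(* Enlarging [A j n] to the joint sigma-field changes nothing, by the product rule with every factor
   except the [j]-th equal to 1. *)
have FY j : is_cond_exp P (F n) (V j n.+1) (Y j).
  have prod1 (f : 'I_m -> T -> R) :
      (fun w => \prod_(i < m) (if i == j then f i else cst 1%R) w)%R = f j.
    apply/funext => w; rewrite (bigD1 j)//= eqxx big1 ?mulr1// => i /negbTE ->.
    by [].
  rewrite -(prod1 (fun i => V i n.+1)) -(prod1 Y).
  apply: (is_cond_exp_prod sG A_independent (H := A^~ n)) => // i;
    case: eqP => // _.
  - exact: GV.
  - by apply/wrt_measurableP => //; exact: measurable_cst.
  - exact: intV.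
  - exact: finite_measure_integrable_cst.
  - split=> //; apply/wrt_measurableP => //; exact: measurable_cst.
have ratioY i : {ae P, forall w,
    cond_exp P (F n) (fun w' => X i n.+1 w' / X i n w')%R w =
    ((V i n w)^-1 * Y i w)%R}.
  (* The denominator is known at time [n], so its inverse is taken out of the conditional
     expectation. *)
  have FVinv : wrt_measurable (F n) (fun w => (V i n w)^-1)%R.
    apply: wrt_measurable_sub (@AF i n) _.
    apply/wrt_measurableP => //; apply: (measurableT_comp measurable_invr).
    exact/wrt_measurableP/AV.
  rewrite (cond_exp_ae_eq (sF n) (X' := fun w => (V i n w)^-1 * V i n.+1 w)%R).
  - apply: cond_exp_ae => //; apply: is_cond_expM => //.
    + by move=> w; rewrite invr_ge0.
    + exact: mV.
  - apply: measurable_funM; first exact: mX.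
    by apply: (measurableT_comp measurable_invr); exact: mX.
  - apply: measurable_funM; last exact: mV.
    exact: wrt_measurable_fun FVinv.
  - apply: filterS (filterI (XV i n0) (XV i (ltn0Sn n))) => w [Xn XSn].
    by rewrite Xn XSn mulrC.
have prodC : {ae P, forall w,
    cond_exp P (F n) (fun w' => \prod_(i < m) X i n.+1 w')%R w =
    (\prod_(i < m) Y i w)%R}.
  rewrite (cond_exp_ae_eq (sF n) _ _ (XprodV (ltn0Sn n))).
  - exact: cond_exp_ae.
  - exact: wrt_measurable_fun (adapted_prod (ltn0Sn n)).
  - by apply: measurable_prod => i _; exact: mV.
have : {ae P, forall w, forall i, (0 < X i n w)%R /\
    cond_exp P (F n) (fun w' => X i n.+1 w' / X i n w')%R w =
    ((V i n w)^-1 * Y i w)%R}.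
  apply: filter_forall => i.
  by apply: filterS (filterI (X_positive i n0) (ratioY i)) => w [].
move=> XY; apply: filterS (filterI prodC XY) => w [-> ratio]; split.
- by move=> i; rewrite (ratio i).2 mulr_ge0// invr_ge0.
- by apply: prodr_gt0 => i _; exact: (ratio i).1.
rewrite -big_split/=; apply: eq_bigr => i _.
have [X0 ->] := ratio i.
by rewrite mulrAC /V max_l ?(ltW X0)// mulVf ?gt_eqF// mul1r.
Qed.

End ConditionalRatio.

(** * Monotone case and optimality for the product *)

Unset Implicit Arguments.

Theorem proposition3p4 (d : measure_display) (T : measurableType d)
    (R : realType) (P : probability T R) (m : nat)
    (A : 'I_m -> nat -> set (set T)) (X : 'I_m -> nat -> T -> R)
    (m_gt0 : (0 < m)%N)
    (A_filtration : forall i, filtration (A i))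
    (A_independent : independent_filtrations P A)
    (X_adapted : forall i, adapted (A i) (X i))
    (X0 : forall i w, X i 0%N w = 1)
    (X_positive : forall i n, (0 < n)%N -> {ae P, forall w, 0 < X i n w})
    (X_integrable : forall i n, (0 < n)%N ->
       P.-integrable [set: T] (EFin \o X i n))
    (X_doob : forall i n, (0 < n)%N ->
       {ae P, forall w, X i n w =
          mult_doob_martingale P (joint_filtration A) (X i) n w *
          \prod_(1 <= j < n.+1)
            (cond_exp P (joint_filtration A j.-1) (X i j) w / X i j.-1 w)})
    (ratio_nonincreasing : forall i n, (0 < n)%N ->
       {ae P, forall w,
          cond_exp P (joint_filtration A n.+1)
            (fun w' => X i n.+2 w' / X i n.+1 w') w <=
          cond_exp P (joint_filtration A n)
            (fun w' => X i n.+1 w' / X i n w') w}) :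
  let F := joint_filtration A in
  let Xprod := fun n w => \prod_(i < m) X i n w in
  let tau := myopic_time P F Xprod in
  (monotone_case P F Xprod /\
   {ae P, forall w, tau w = first_time (fun n =>
      \prod_(i < m)
        cond_exp P (F n) (fun w' => X i n.+1 w' / X i n w') w <= 1)}) /\
  ((limn (fun L : nat => \int[P]_w stopped Xprod (min_time tau L) w) <=
      \int[P]_w stopped Xprod tau w)%E ->
   optimal P F Xprod tau).
Proof.
move=> F Xprod tau.
have sF n : sub_sigma_field (F n) by exact: joint_filtration_sub.
have F_mono n k : (n <= k)%N -> F n `<=` F k by exact: joint_filtration_mono.
have ratio n (n0 : (0 < n)%N) := cond_exp_prod_ratio A_filtration A_independent
  X_adapted X_positive X_integrable n0.
have le_ratio n : (0 < n)%N -> {ae P, forall w,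
    (cond_exp P (F n) (Xprod n.+1) w <= Xprod n w) =
    (\prod_(i < m)
      cond_exp P (F n) (fun w' => X i n.+1 w' / X i n w') w <= 1)}.
  move=> n0; apply: filterS (ratio n n0) => w [_ Xw ->].
  by rewrite -[leRHS]mul1r ler_pM2r.
have mono : monotone_case P F Xprod.
  split.
  - exact: adapted_prod.
  - exact: integrable_prod.
  move=> n n0.
  have dec : {ae P, forall w, forall i,
      cond_exp P (F n.+1) (fun w' => X i n.+2 w' / X i n.+1 w') w <=
      cond_exp P (F n) (fun w' => X i n.+1 w' / X i n w') w}.
    by apply: filter_forall => i; exact: ratio_nonincreasing.
  apply: filterS (filterI dec (filterI (ratio n.+1 (ltn0Sn n))
    (filterI (le_ratio n n0) (le_ratio n.+1 (ltn0Sn n))))).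
  move=> w [decw [[ge0 _ _] [-> ->]]]; apply: le_trans.
  (* Comparing the products factor by factor uses that the smaller factors, those at [n.+1], are
     nonnegative. *)
  by apply: ler_prod => i _; rewrite ge0 decw.
split; first split=> //.
  have : {ae P, forall w, forall n, (0 < n)%N ->
    (cond_exp P (F n) (Xprod n.+1) w <= Xprod n w) =
    (\prod_(i < m)
      cond_exp P (F n) (fun w' => X i n.+1 w' / X i n w') w <= 1)}.
    apply: ae_foralln => -[|n]; first exact: aeW.
    by apply: filterS (le_ratio n.+1 (ltn0Sn n)) => w + _.
  by apply: filterS => w; exact: eq_first_time.
apply: monotone_case_optimal => //.
(* Measurability and nonnegativity are also required at index 0, where the product is 1 by the
   convention [X0]. *)
- move=> [|n].
    rewrite (_ : Xprod 0%N = cst 1)//.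
    by apply/funext => w; rewrite /Xprod big1.
  by case: mono => /(_ n.+1 (ltn0Sn n))/(wrt_measurable_fun (sF _)).
- move=> [|n]; first by apply: aeW => w; rewrite /Xprod big1.
  by apply: filterS (ratio n.+1 (ltn0Sn n)) => w [_ /ltW].
Qed.
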